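(* Let $w$ be an element of a twisted Weyl group $W$. (i) For any simple root $\alpha$ not in the inversion set $\mathfrak{R}_w$, the set $\mathrm{cross}_w(\alpha)$ contains simple roots. (ii) For any other element $w'$ of $W$ and integer $d\geq0$, we have $$\mathrm{DG}(b_w^d)\geq w'\quad\text{if and only if}\quad \mathrm{cross}_w^d(\mathfrak{R}_{w'})=\varnothing,$$ if and only if $\mathrm{cross}_w^d(\mathfrak{R}_{w'})$ does not contain any simple roots. (iii) Moreover, for any integer $d>|\mathfrak{R}_+\setminus\mathfrak{R}^w_{\mathrm{st}}|-\ell(w)$ we have $$w\text{ is convex and }\mathrm{DG}(b_w^d)=\mathrm{pb}(w)\quad\text{if and only if}\quad \mathrm{cross}_w^d(\mathfrak{R}_+\setminus\mathfrak{R}^w_{\mathrm{st}})=\varnothing,$$ if and only if $\mathrm{cross}_w^d(\mathfrak{R}_+\setminus\mathfrak{R}^w_{\mathrm{st}})$ does not contain any simple roots.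
   Context: Let $\mathfrak{R}$ be a crystallographic root system with positive roots $\mathfrak{R}_+$ and Weyl group $\tilde W$, and let $\Omega$ be a group of automorphisms of $\mathfrak R$ permuting the simple roots (''twists''). $W=\Omega\ltimes\tilde W$ is called a twisted Weyl group. For $w\in W$: $\mathfrak{R}_w=\{\beta\in\mathfrak{R}_+:w(\beta)\in-\mathfrak{R}_+\}$ is the inversion set and $\ell(w)=|\mathfrak{R}_w|$; $\mathfrak{R}^w_{\mathrm{st}}$ is the set of stable roots, i.e. roots $\beta$ such that either all $w^i(\beta)$ ($i\in\mathbb Z$) are positive or all are negative. The element $w$ is convex if $\mathfrak{R}^w_{\mathrm{st}}$ is a standard parabolic subsystem. For $\beta\in\mathfrak{R}_+$, $\mathrm{cross}_w(\beta):=\{w(\beta+\sum_{i=1}^m\beta_i)\in\mathfrak{R}:\beta_1,\ldots,\beta_m\in\mathfrak{R}_w,\ m\ge0\}\cap\mathfrak{R}_+$ (repetitions allowed); for $\mathfrak{N}\subseteq\mathfrak{R}_+$, $\mathrm{cross}_w(\mathfrak{N}):=\bigcup_{\beta\in\mathfrak{N}}\mathrm{cross}_w(\beta)$, and $\mathrm{cross}_w^d$ is its $d$-th iterate. Weak left Bruhat-Chevalley order: $y\ge x$ if and only if $\ell(y)=\ell(yx^{-1})+\ell(x)$, equivalently $\mathfrak{R}_x\subseteq\mathfrak{R}_y$. The twisted braid monoid has generators $b_x$ ($x\in W$, ''reduced braids'') and relations $b_xb_y=b_{xy}$ whenever $\ell(xy)=\ell(x)+\ell(y)$. For a braid $b$,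 the (right) Deligne-Garside factor $\mathrm{DG}(b)$ is the largest element $x$ in the weak left order such that $b=b'b_x$ for some $b'$ in the monoid. Since twists have length $0$ it is determined up to left multiplication by twists, and equalities involving it are understood up to such twists (i.e. as equalities of inversion sets). For convex $w$, the braid power bound $\mathrm{pb}(w)$ is the element with inversion set $\mathfrak{R}_+\setminus\mathfrak{R}^w_{\mathrm{st}}$, i.e. $w_\circ w_{\circ,J}$ where $w_\circ$ is the longest element and $w_{\circ,J}$ is the longest element of the standard parabolic subgroup with root system $\mathfrak{R}^w_{\mathrm{st}}$.
   Formalization: In (iii), ''w is convex'' is replaced by ''some Weyl group element pb(w) has inversion set R_+ minus the stable roots'', which convexity is shown to imply; the literal claim fails for w = s_1 in type A_2, d = 1, where the crossing set is empty but w is not convex. *)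

(* Defs.v *)
From HB Require Import structures.
From mathcomp Require Import all_boot all_order all_algebra all_fingroup.
From mathcomp Require Import boolp reals.
Set Implicit Arguments.
Unset Strict Implicit.
Unset Printing Implicit Defensive.
Import Order.TTheory GRing.Theory Num.Theory.
Local Open Scope ring_scope.

(* Finite reduced crystallographic root systems in a Euclidean space [V]. *)
Record rootSystem (R : realType) (V : vectType R) := RootSystem {
  dot : V -> V -> R;
  roots : seq V;
  dotC : forall u v, dot u v = dot v u;
  dot_linear : forall u, scalar (dot u);
  dot_pos : forall u, u != 0 -> 0 < dot u u;
  roots_neq0 : 0 \notin roots;
  roots_span : <<roots>>%VS = fullv;
  roots_refl : forall a b, a \in roots -> b \in roots ->
    b - (2 * dot a b / dot a a) *: a \in roots;
  roots_int : forall a b, a \in roots -> b \in roots ->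
    2 * dot a b / dot a a \is a Num.int;
  roots_reduced : forall a (c : R), a \in roots -> c *: a \in roots ->
    c = 1 \/ c = -1 }.

Section RootSystem.
Variables (R : realType) (V : vectType R) (Phi : rootSystem V).

Definition rootT := seq_sub (roots Phi).

Implicit Types (a b c g : rootT) (J D N : {set rootT}).

(* Since the roots span [V], automorphisms of the root system are identified
   with the permutations of the roots that they induce. *)
Definition automorphism (p : {perm rootT}) :=
  exists f : 'End(V), forall b, f (val b) = val (p b).

Definition reflection (p : {perm rootT}) := [exists a : rootT, [forall b : rootT,
  val (p b) == val b - (2 * dot Phi (val a) (val b) / dot Phi (val a) (val a))
                         *: val a]].

Definition weyl : {group {perm rootT}} := <<[set p | reflection p]>>%G.

Definition pos D : {set rootT} :=
  [set b | `[< exists c : rootT -> nat,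
                 val b = \sum_(a in D) (val a *+ c a) >]].

Definition neg D : {set rootT} :=
  [set b | [exists c in pos D, val b == - val c]].

Definition simple_system D :=
  basis_of fullv [seq val a | a in D] /\
  (forall b, b \in pos D \/ b \in neg D).

Definition standard_parabolic J : {set rootT} :=
  [set b | val b \in <<[seq val a | a in J]>>%VS].

Variable D : {set rootT}.

Definition twists (Omega : {group {perm rootT}}) :=
  forall p : {perm rootT}, p \in Omega -> automorphism p /\ p @: D = D.

Variable Omega : {group {perm rootT}}.

(* The twisted Weyl group.  [Omega] normalises [weyl] and, when
   [twists Omega] holds, meets it trivially (an element of [weyl] permuting the
   simple roots is the identity), so this join is the semidirect product. *)
Definition twisted_weyl : {group {perm rootT}} := (Omega <*> weyl)%G.

Notation W := (subg_of twisted_weyl).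
Implicit Types (x y w : W).

Definition wact w b : rootT := sgval w b.

(* The product xy of the mathematical text, i.e. first [y], then [x]:
   multiplication of permutations in the library composes the other way. *)
Definition wmul x y : W := (y * x)%g.

Lemma act_wmul x y b : wact (wmul x y) b = wact x (wact y b).
Proof. by rewrite /wact /= permM. Qed.

Definition inversions w : {set rootT} :=
  [set b in pos D | wact w b \in neg D].

Definition len w : nat := #|inversions w|.

Definition weak_le x y := len y = (len (wmul y x^-1) + len x)%N.

(* Equality up to left multiplication by twists. *)
Definition eq_twist x y := inversions x = inversions y.

Definition stable w : {set rootT} :=
  [set b | `[< (forall i : nat, wact (w ^+ i) b \in pos D /\
                                wact (w ^- i) b \in pos D) \/
               (forall i : nat, wact (w ^+ i) b \in neg D /\
                                wact (w ^- i) b \in neg D) >]].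

Definition unstable_pos w : {set rootT} := pos D :\: stable w.

Definition convex w :=
  exists2 J : {set rootT}, J \subset D & stable w = standard_parabolic J.

(* As [w] acts linearly and permutes the roots, w(v) is a root if and only if
   v is; the seq [s] is the list of inversions (with repetitions) added. *)
Definition cross1 w b : {set rootT} :=
  [set wact w g | g in [set g : rootT | `[< exists s : seq rootT,
     {subset s <= inversions w} /\
     val g = val b + \sum_(c <- s) val c >]]] :&: pos D.

Definition cross w N : {set rootT} := \bigcup_(b in N) cross1 w b.

(* Braids are words in the generators b_x, up to the congruence [braid_eq]
   of the twisted braid monoid.  The additive relations only make b_1
   idempotent; [braid_one] identifies it with the unit of the monoid. *)
Inductive braid_eq : seq W -> seq W -> Prop :=
| braid_refl u : braid_eq u u
| braid_sym u v : braid_eq u v -> braid_eq v u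
| braid_trans u v t : braid_eq u v -> braid_eq v t -> braid_eq u t
| braid_mul u v x y : len (wmul x y) = (len x + len y)%N ->
    braid_eq (u ++ x :: y :: v) (u ++ wmul x y :: v)
| braid_one u v : braid_eq (u ++ 1%g :: v) (u ++ v).

Definition braid_power w (d : nat) : seq W := nseq d w.

Definition right_factor (b : seq W) x :=
  exists b' : seq W, braid_eq b (rcons b' x).

Definition is_DG (b : seq W) x :=
  right_factor b x /\ (forall y, right_factor b y -> weak_le y x).

(* [is_DG] determines the factor up to twists; [DG] selects a representative. *)
Definition DG (b : seq W) : W := odflt 1%g [pick x : W | `[< is_DG b x >]].

Definition is_pb w x :=
  (sgval x \in weyl) && (inversions x == unstable_pos w).

(* [pb w] is meaningful only if [has_pb w], which holds for convex [w] but not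
   only for them.  In type A2 with simple roots a1, a2, the simple reflection
   s1 has stable roots +-a2, +-(a1 + a2), which do not form a root subsystem,
   so s1 is not convex; but its only unstable positive root is a1, so s1 is its
   own power bound, DG(b_s1^d) = s1 for d > 0, and cross_s1({a1}) is empty.
   Hence the emptiness of the crossing sets detects
   [has_pb w /\ DG (b_w^d) = pb w], and convexity cannot be deduced from it. *)
Definition has_pb w := exists x, is_pb w x.

Definition pb w : W := odflt 1%g [pick x : W | is_pb w x].

End RootSystem.

(* Main.v *)
Require Import Defs.
From mathcomp Require Import all_boot all_order all_algebra all_fingroup.
From mathcomp Require Import boolp reals.
From mathcomp Require Import zify ring lra.
From HB Require Import structures.

Set Implicit Arguments.
Unset Strict Implicit.
Unset Printing Implicit Defensive.
Import Order.TTheory GRing.Theory Num.Theory.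
Local Open Scope ring_scope.

(** Call a set of positive roots coclosed if it contains one of two positive
roots whenever it contains a root that is their sum.  Three kinds of sets are
coclosed: singletons of simple roots, inversion sets, and the set of unstable
positive roots.  Two facts drive the proof.

Crossing preserves coclosedness (cross_coclosed).  This comes down to the
elementary statement sum_sub_root: if m + n and m + n - d are roots, then m - d
or n - d is a root or zero.  A nonempty coclosed set contains a simple root,
namely an element of least height (coclosed_simple_root).  Hence an iterated
crossing set of a coclosed set is empty as soon as it contains no simple root,
and crossing a simple root outside the inversion set, which yields at least its
image, yields a simple root.

The set of roots that are sums of elements of a coclosed set is coclosed again
(ncl_coclosed), and a set that is both closed under sums and coclosed is the
inversion set of an element of the Weyl group (biclosed_inv).  So inversion
sets have joins, inv_join, and a join stays inside every set closed under sums
that contains both parts.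

Write x <= y for inclusion of inversion sets.  An element y is a right factor of
a braid b b_w exactly when some right factor z of b satisfies y <= zw with zw
reduced; the predicate below is this recursion, right_factorP proves it correct,
and joins make the set of right factors directed, so that its maximum DG
exists.  For coclosed N and one factor w the crossing set records exactly what
is needed: if N lies in the inversion set of a reduced product zw then cross_w(N)
lies in the inversion set of z; conversely, if cross_w(N) lies in that of z, then
the sums of elements of cross_w(N) form the inversion set of some u <= z such
that uw is reduced and N lies in the inversion set of uw.  By induction on d,
cross_w^d(N) is empty if and only if N lies in the inversion set of DG(b_w^d)
(iter_cross_eq0).

For the power bound, the orbit of a stable positive root never leaves the
iterated crossing sets, so the inversion set of DG(b_w^d) consists of unstable
roots for every d (inv_DG_unstable); the d-th crossing set of the set of unstable
positive roots is therefore empty exactly when both sets are equal. *)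

(** * Strings of roots *)

Section Roots.
Variables (R : realType) (V : vectType R) (Phi : rootSystem V).
Notation rootT := (rootT Phi).
Notation roots := Defs.roots.
Notation "u '*d' v" := (dot Phi u v) (at level 40).
Implicit Types a b c g m n : rootT.

HB.instance Definition _ (u : V) :=
  GRing.isLinear.Build R V R *%R (dot Phi u) (dot_linear Phi u).

Lemma val_root a : val a \in roots Phi.
Proof. exact: valP. Qed.

Lemma root_of (v : V) : v \in roots Phi -> exists a, val a = v.
Proof. by move=> hv; exists (SeqSub hv). Qed.

Lemma val_neq0 a : val a != 0.
Proof.
by apply: contraNneq (roots_neq0 Phi) => <-; apply: val_root.
Qed.

Lemma dotDr u v v' : u *d (v + v') = u *d v + u *d v'.
Proof. exact: linearD. Qed.
Lemma dotNr u v : u *d (- v) = - (u *d v).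
Proof. exact: linearN. Qed.
Lemma dot0r u : u *d 0 = 0.
Proof. exact: linear0. Qed.
Lemma dot_sumr u (s : seq rootT) :
  u *d (\sum_(c <- s) val c) = \sum_(c <- s) u *d val c.
Proof. exact: linear_sum. Qed.
Lemma dotDl u v v' : (v + v') *d u = v *d u + v' *d u.
Proof. by rewrite !(dotC Phi _ u) dotDr. Qed.
Lemma dotNl u v : (- v) *d u = - (v *d u).
Proof. by rewrite !(dotC Phi _ u) dotNr. Qed.

Lemma dot_val_gt0 a : 0 < val a *d val a.
Proof. by apply: dot_pos; apply: val_neq0. Qed.

Lemma opp_root a : exists b, val b = - val a.
Proof.
have := roots_refl (val_root a) (val_root a).
rewrite mulfK ?gt_eqF ?dot_val_gt0 // scaler_nat mulr2n opprD addrA subrr add0r.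
exact: root_of.
Qed.

Definition ropp a := sval (cid (opp_root a)).

Lemma val_ropp a : val (ropp a) = - val a.
Proof. exact: svalP (cid (opp_root a)). Qed.

Lemma roppK : involutive ropp.
Proof. by move=> a; apply: val_inj; rewrite !val_ropp opprK. Qed.

Lemma int_eq1 (x : R) : x \is a Num.int -> 0 < x -> x < 2 -> x = 1.
Proof.
case/intrP=> n ->; rewrite ltr0z => h0.
have -> : (2 : R) = 2%:~R by [].
rewrite ltr_int => h2; suff -> : n = 1 by [].
lia.
Qed.

(** If both integers 2(a,b)/(a,a) and 2(a,b)/(b,b) were at least 2, then a - b would
have nonpositive square length; so one of them is 1, and the corresponding
reflection produces plus or minus a - b. *)
Lemma root_sub a b : 0 < val a *d val b -> a != b ->
  exists c, val c = val a - val b.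
Proof.
move=> hab neq; have ha := dot_val_gt0 a; have hb := dot_val_gt0 b.
case: (ltrP (2 * (val b *d val a) / (val b *d val b)) 2) => h2.
  have e := int_eq1 (roots_int (val_root b) (val_root a)) _ h2.
  have := roots_refl (val_root b) (val_root a).
  rewrite e ?scale1r; first exact: root_of.
  by rewrite dotC divr_gt0 // mulr_gt0.
case: (ltrP (2 * (val a *d val b) / (val a *d val a)) 2) => h1.
  have e := int_eq1 (roots_int (val_root a) (val_root b)) _ h1.
  have := roots_refl (val_root a) (val_root b).
  rewrite e ?scale1r; last by rewrite divr_gt0 // mulr_gt0.
  by case/root_of=> c hc; exists (ropp c); rewrite val_ropp hc opprB.
have /(dot_pos Phi) : val a - val b != 0 by rewrite subr_eq0 (inj_eq val_inj).
rewrite dotDl !dotDr !dotNl !dotNr opprK.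
move: h1 h2; rewrite !ler_pdivlMr // (dotC Phi (val b) (val a)); lra.
Qed.

(** Otherwise root_sub bounds four products: d has nonpositive products with m and
n, and so has b with n and m, since m - d = b - n and n - d = b - m.  Then
(b, g) <= 0, whereas b = g - d gives (b, g) = (g, g) - (d, m + n) > 0. *)
Lemma sum_sub_root m n g (d b : rootT) :
  val g = val m + val n -> val b = val g - val d ->
  (m = d \/ exists c, val c = val m - val d) \/
  (n = d \/ exists c, val c = val n - val d).
Proof.
move=> hg hb.
have use (p q r s : rootT) : 0 < val p *d val q -> val r - val s = val p - val q ->
    r = s \/ exists c, val c = val r - val s.
  move=> h e; have [epq|npq] := eqVneq p q.
    by left; apply/val_inj/eqP; rewrite -subr_eq0 e epq subrr.
  by right; rewrite e; apply: root_sub.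
have [|h1] := ltrP 0 (val m *d val d); first by move/use=> h; left; apply: h.
have [|h2] := ltrP 0 (val n *d val d); first by move/use=> h; right; apply: h.
have [|h3] := ltrP 0 (val b *d val n).
  by move/use=> h; left; apply: h; rewrite hb hg addrAC addrK.
have [|h4] := ltrP 0 (val b *d val m).
  by move/use=> h; right; apply: h; rewrite hb hg addrAC [val m + _]addrC addrK.
have : val b *d (val m + val n) <= 0 by rewrite dotDr; lra.
rewrite -hg hb dotDl dotNl (dotC Phi (val d)) {3}hg dotDl => h5.
exfalso; have := dot_val_gt0 g; lra.
Qed.

(** Used with v a root that is a sum of roots: root_sub then allows a summand to be
split off. *)
Lemma pos_pairing (v u : V) (s : seq rootT) : v = u + \sum_(c <- s) val c ->
  v != 0 -> 0 < v *d u \/ exists2 c, c \in s & 0 < v *d val c.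
Proof.
move=> e /(dot_pos Phi); rewrite {2}e dotDr dot_sumr => h.
have [|hu] := ltrP 0 (v *d u); first by left.
right; apply: contrapT => hs.
have : \sum_(c <- s) v *d val c <= 0; last by lra.
rewrite big_seq; apply: sumr_le0 => c cs; rewrite leNgt; apply/negP => hc.
by apply: hs; exists c.
Qed.

End Roots.

(** * Coordinates, heights and simple reflections *)

Section Height.
Variables (R : realType) (V : vectType R) (Phi : rootSystem V).
Notation rootT := (rootT Phi).
Notation "u '*d' v" := (dot Phi u v) (at level 40).
Variable D : {set rootT}.
Implicit Types a b c g m n : rootT.

Notation simples := (in_tuple [seq val a | a in D]).

(** The coordinate of a vector on a simple root; summing over the indices that carry
the root avoids choosing one, and makes the function zero for other roots. *)
Definition coef a : V -> R :=
  fun v => \sum_(i < size simples | simples`_i == val a) coord simples i v.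

Lemma coef_linear a : scalar (coef a).
Proof.
move=> k u v; rewrite /coef mulr_sumr -big_split /=.
by apply: eq_bigr => i _; rewrite linearP.
Qed.

HB.instance Definition _ a :=
  GRing.isLinear.Build R V R *%R (coef a) (coef_linear a).

Definition ht (v : V) : R := \sum_(a in D) coef a v.

Lemma ht_linear : scalar ht.
Proof.
move=> k u v; rewrite /ht mulr_sumr -big_split /=.
by apply: eq_bigr => i _; rewrite linearP.
Qed.

HB.instance Definition _ := GRing.isLinear.Build R V R *%R ht ht_linear.

Lemma htD u v : ht (u + v) = ht u + ht v. Proof. exact: linearD. Qed.
Lemma htN u : ht (- u) = - ht u. Proof. exact: linearN. Qed.
Lemma ht_sum (s : seq rootT) : ht (\sum_(c <- s) val c) = \sum_(c <- s) ht (val c).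
Proof. exact: linear_sum. Qed.

Lemma ht_ropp a : ht (val (ropp a)) = - ht (val a).
Proof. by rewrite val_ropp htN. Qed.

Hypothesis hD : simple_system D.

Lemma coef_simple a b : a \in D -> b \in D -> coef a (val b) = (a == b)%:R.
Proof.
move=> aD bD; have [hb _] := hD.
have hfree := basis_free hb.
have huniq : uniq simples.
  by rewrite map_inj_uniq ?enum_uniq //; apply: val_inj.
have inX c : c \in D -> exists i : 'I_(size [seq val a | a in D]), simples`_i = val c.
  move=> cD; have cX : val c \in [seq val a | a in D] by apply: map_f; rewrite mem_enum.
  have := cX; rewrite -index_mem => h; exists (Ordinal h); exact: nth_index.
have [i ei] := inX a aD; have [j ej] := inX b bD.
rewrite /coef (big_pred1 i).
  rewrite -ej coord_free //.
  suff -> : (j == i) = (a == b) by [].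
  apply/eqP/eqP => [eji|eab]; first by apply: val_inj; rewrite -ei -ej eji.
  apply/val_inj/eqP; rewrite -(nth_uniq 0 (ltn_ord j) (ltn_ord i) huniq).
  by rewrite ei ej eab.
by move=> k; rewrite -ei nth_uniq.
Qed.

Lemma ht_simple a : a \in D -> ht (val a) = 1.
Proof.
move=> aD; rewrite /ht (bigD1 a) //= coef_simple // eqxx big1 ?addr0 //.
by move=> b /andP[bD /negPf nb]; rewrite coef_simple // nb.
Qed.

Lemma coef_pos a b (c : rootT -> nat) : a \in D ->
  val b = \sum_(a in D) val a *+ c a -> coef a (val b) = (c a)%:R.
Proof.
move=> aD ->; rewrite linear_sum /= (bigD1 a) //= linearMn /= coef_simple // eqxx.
rewrite big1 ?addr0 // => x /andP[xD /negPf nx].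
by rewrite linearMn /= coef_simple // eq_sym nx mul0rn.
Qed.

Lemma ht_pos b (c : rootT -> nat) :
  val b = \sum_(a in D) val a *+ c a -> ht (val b) = \sum_(a in D) (c a)%:R.
Proof. by move=> e; apply: eq_bigr => a aD; apply: coef_pos. Qed.

Lemma posP b : reflect (exists c : rootT -> nat, val b = \sum_(a in D) val a *+ c a)
  (b \in pos D).
Proof. by rewrite inE; apply: asboolP. Qed.

Lemma negE b : (b \in neg D) = (ropp b \in pos D).
Proof.
rewrite inE; apply/existsP/idP => [[c /andP[cP /eqP e]]|h].
  suff -> : ropp b = c by [].
  by apply: val_inj; rewrite val_ropp e opprK.
by exists (ropp b); rewrite h val_ropp opprK eqxx.
Qed.

Lemma coef_ge0 a b : a \in D -> b \in pos D -> 0 <= coef a (val b).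
Proof. by move=> aD /posP[c e]; rewrite (coef_pos aD e) ler0n. Qed.

Lemma pos_ht_gt0 b : b \in pos D -> 0 < ht (val b).
Proof.
case/posP=> c e; rewrite (ht_pos e) -natr_sum ltr0n lt0n sum_nat_eq0.
apply: contra (val_neq0 b) => /forall_inP h.
by rewrite e big1 // => a /h /eqP ->.
Qed.

Lemma posE b : (b \in pos D) = (0 < ht (val b)).
Proof.
apply/idP/idP; first exact: pos_ht_gt0.
have [//|] := (proj2 hD) b.
rewrite negE => /pos_ht_gt0; rewrite ht_ropp; lra.
Qed.

Lemma negHt b : (b \in neg D) = (ht (val b) < 0).
Proof. by rewrite negE posE ht_ropp oppr_gt0. Qed.

Lemma ht_neq0 b : ht (val b) != 0.
Proof.
have [] := (proj2 hD) b; rewrite ?negHt ?posE; first exact: lt0r_neq0.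
exact: ltr0_neq0.
Qed.

Lemma ht_sign b : (0 < ht (val b)) = ~~ (ht (val b) < 0).
Proof. by have := ht_neq0 b; case: ltrgtP. Qed.

Lemma ht_simple_gt0 a : a \in D -> 0 < ht (val a).
Proof. by move=> /ht_simple ->. Qed.

Lemma ht_pos_ge1 b : 0 < ht (val b) -> 1 <= ht (val b).
Proof.
move=> hb; have := hb; rewrite -posE => /posP[c e].
by move: hb; rewrite (ht_pos e) -natr_sum ltr0n ler1n.
Qed.

(** A nonsimple positive root has positive product with some simple root in its
support, which can be subtracted. *)
Lemma pos_decomp g : 0 < ht (val g) -> g \notin D ->
  exists m n, [/\ 0 < ht (val m), 0 < ht (val n) & val g = val m + val n].
Proof.
move=> hg gD; have := hg; rewrite -posE => /posP[k e].
have := dot_val_gt0 g; rewrite {2}e linear_sum /= => h.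
have [a [aD ka ga]] : exists a, [/\ a \in D, (0 < k a)%N & 0 < val g *d val a].
  apply: contrapT => hn; move: h; apply/negP; rewrite -leNgt.
  apply: sumr_le0 => a aD; rewrite linearMn /=.
  case: (posnP (k a)) => [->|ka]; first by rewrite mulr0n.
  rewrite pmulrn_lle0 // leNgt; apply/negP => ga; apply: hn; exists a; split=> //.
have nga : g != a by apply: contraNneq gD => ->.
have [n hn] := root_sub ga nga.
exists a, n; split; first exact: ht_simple_gt0.
  rewrite -posE; apply/posP; exists (fun b => (k b - (b == a))%N).
  rewrite hn e [LHS]addrC (bigD1 a) //= [in RHS](bigD1 a) //= eqxx addrA.
  congr (_ + _); last first.
    by apply: eq_bigr => b /andP[_ /negPf ->]; rewrite subn0.
  by rewrite mulrnBr // mulr1n addrC.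
by rewrite hn addrC subrK.
Qed.

Lemma ht_gt0_ind (P : rootT -> Prop) :
  (forall g, 0 < ht (val g) ->
     (forall b, 0 < ht (val b) -> ht (val b) < ht (val g) -> P b) -> P g) ->
  forall g, 0 < ht (val g) -> P g.
Proof.
move=> IH g hg; apply: contrapT => nP.
have hg' : (0 < ht (val g)) && ~~ `[< P g >] by rewrite hg; apply/asboolPn.
case: (@arg_minP _ _ _ g [pred b | (0 < ht (val b)) && ~~ `[< P b >]]
  (fun b => ht (val b)) hg') => b /andP[hb /asboolPn nPb] hmin.
apply: nPb; apply: IH => // c hc hcb; apply: contrapT => nPc.
have := hmin c; rewrite /= hc /=.
have -> : ~~ `[< P c >] by apply/asboolPn.
by move=> /(_ isT); rewrite leNgt hcb.
Qed.

Definition refl_fun a (v : V) : V :=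
  v - (2 * (val a *d v) / (val a *d val a)) *: val a.

Lemma refl_fun_linear a : linear (refl_fun a).
Proof.
move=> k u v; rewrite /refl_fun linearP /= scalerBr scalerA [RHS]addrACA.
rewrite -opprD -scalerDl; congr (_ - _ *: _); ring.
Qed.

HB.instance Definition _ a :=
  GRing.isLinear.Build R V V *:%R (refl_fun a) (refl_fun_linear a).

Definition refl_root a b : rootT := SeqSub (roots_refl (valP a) (valP b)).

Lemma refl_funK a : involutive (refl_fun a).
Proof.
move=> v; have e : val a *d refl_fun a v = - (val a *d v).
  rewrite /refl_fun linearB linearZ /= divfK ?gt_eqF ?dot_val_gt0 //; ring.
by rewrite {1}/refl_fun e mulrN mulNr scaleNr opprK subrK.
Qed.

Lemma refl_root_inj a : injective (refl_root a).
Proof.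
by move=> b c /(congr1 val) /(can_inj (refl_funK a)) /val_inj.
Qed.

Definition refl_perm a : {perm rootT} := perm (@refl_root_inj a).

Lemma refl_permE a b : val (refl_perm a b) = refl_fun a (val b).
Proof. by rewrite permE. Qed.

Lemma refl_perm_weyl a : refl_perm a \in weyl Phi.
Proof.
apply: mem_gen; rewrite inE; apply/existsP; exists a; apply/forallP => b.
by rewrite refl_permE.
Qed.

Lemma refl_fun_self a : refl_fun a (val a) = - val a.
Proof.
rewrite /refl_fun mulfK ?gt_eqF ?dot_val_gt0 // scaler_nat mulr2n opprD addrA.
by rewrite subrr add0r.
Qed.

(** A positive root other than a has a positive coordinate at some simple b
different from a, because it is not a multiple of a; the reflection does not
change that coordinate, so the image cannot be negative. *)
Lemma refl_perm_pos a g : a \in D -> 0 < ht (val g) -> g != a ->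
  0 < ht (val (refl_perm a g)).
Proof.
move=> aD hg nga; have := hg; rewrite -posE => gp; have [k e] := posP _ gp.
have [b [bD nba kb]] : exists b, [/\ b \in D, b != a & (0 < k b)%N].
  apply: contrapT => hn.
  have eg : val g = (k a)%:R *: val a.
    rewrite e (bigD1 a) //= big1 ?addr0 ?scaler_nat // => b /andP[bD nba].
    case: (posnP (k b)) => [->|kb]; first by rewrite mulr0n.
    by case: hn; exists b.
  have := @roots_reduced _ _ Phi (val a) (k a)%:R (val_root a).
  rewrite -eg => /(_ (val_root g))[] ek.
    by case/eqP: nga; apply: val_inj; rewrite eg ek scale1r.
  have := ler0n R (k a); rewrite ek; lra.
rewrite ht_sign; apply/negP; rewrite -negHt negE => /(coef_ge0 bD).
rewrite val_ropp linearN /= refl_permE /refl_fun linearB linearZ /=.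
rewrite (coef_pos bD e) coef_simple // (negPf nba) mulr0 subr0.
by rewrite oppr_ge0 leNgt ltr0n kb.
Qed.

End Height.

(** * Linearity of the twisted Weyl group *)

Section Action.
Variables (R : realType) (V : vectType R) (Phi : rootSystem V).
Notation rootT := (rootT Phi).
Variables (D : {set rootT}) (Omega : {group {perm rootT}}).
Hypotheses (hD : simple_system D) (hOmega : twists D Omega).
Implicit Types (a b c g m n : rootT) (N M B : {set rootT}) (s : seq rootT).
Notation W := (subg_of (twisted_weyl Omega)).
Implicit Types u w x y z : W.
Notation ht := (ht D).
Notation inversions := (@inversions R V Phi D Omega).
Notation "g %:ht" := (ht (val g)) (at level 2, format "g %:ht").

Lemma reflection_automorphism (p : {perm rootT}) : reflection p -> automorphism p.
Proof.
case/existsP=> a /forallP ha; exists (linfun (refl_fun (Phi := Phi) a)) => b.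
by rewrite lfunE /=; rewrite (eqP (ha b)).
Qed.

Lemma automorphism_group_set : group_set [set p : {perm rootT} | `[< automorphism p >]].
Proof.
apply/group_setP; split=> [|p q].
  by rewrite inE; apply/asboolP; exists \1%VF => b; rewrite lfunE /= perm1.
rewrite !inE => /asboolP[f hf] /asboolP[h hh]; apply/asboolP.
by exists (h \o f)%VF => b; rewrite lfunE /= hf hh permM.
Qed.

(** Reflections and twists are induced by linear maps, hence so is every element of
the group that they generate. *)
Lemma wact_linear w : exists f : 'End(V), forall b, f (val b) = val (wact w b).
Proof.
have sub : twisted_weyl Omega \subset Group automorphism_group_set.
  rewrite join_subG gen_subG; apply/andP; split; apply/subsetP => p.
    by case/hOmega => hp _; rewrite inE; apply/asboolP.
  by rewrite !inE => /reflection_automorphism hp; apply/asboolP.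
by have := subsetP sub _ (subgP w); rewrite inE => /asboolP.
Qed.

Lemma wactK w : cancel (wact w) (wact w^-1%g).
Proof. by move=> b; rewrite /wact (_ : sgval w^-1 = (sgval w)^-1)%g // permK. Qed.

Lemma wactVK w : cancel (wact w^-1%g) (wact w).
Proof. by move=> b; rewrite /wact (_ : sgval w^-1 = (sgval w)^-1)%g // permKV. Qed.

Lemma wact1 b : wact (1%g : W) b = b.
Proof. by rewrite /wact perm1. Qed.

Lemma wact_sum w g s : val g = \sum_(c <- s) val c ->
  val (wact w g) = \sum_(c <- s) val (wact w c).
Proof.
move=> e; have [f hf] := wact_linear w; rewrite -!hf e linear_sum /=.
by apply: eq_bigr => c _; rewrite hf.
Qed.

Lemma wactD w g m n : val g = val m + val n ->
  val (wact w g) = val (wact w m) + val (wact w n).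
Proof.
by move=> e; have [f hf] := wact_linear w; rewrite -!hf e linearD.
Qed.

Lemma wactN w b : wact w (ropp b) = ropp (wact w b).
Proof.
apply: val_inj; have [f hf] := wact_linear w.
by rewrite -hf !val_ropp linearN /= hf.
Qed.

Lemma mem_inv w b : (b \in inversions w) = (0 < b%:ht) && ((wact w b)%:ht < 0).
Proof. by rewrite inE posE // negHt. Qed.

Lemma inv_sub_pos w : inversions w \subset pos D.
Proof. by apply/subsetP => b; rewrite inE => /andP[]. Qed.

Lemma ropp_inv w b : b%:ht < 0 -> 0 < (wact w b)%:ht -> ropp b \in inversions w.
Proof. by rewrite mem_inv wactN !ht_ropp oppr_gt0 oppr_lt0 => -> ->. Qed.

Lemma notin_inv w b : 0 < (wact w b)%:ht -> b \notin inversions w.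
Proof. by rewrite mem_inv negb_and -[~~ (_ < 0)]ht_sign // orbC => ->. Qed.

Lemma notin_inv_pos w b : 0 < b%:ht -> b \notin inversions w -> 0 < (wact w b)%:ht.
Proof. by rewrite mem_inv [_ < (wact _ _)%:ht]ht_sign // => ->. Qed.

(** * Closed and coclosed sets of roots *)

(** The empty sum is included, which is harmless for roots since they are nonzero. *)
Definition ncomb N (v : V) := exists2 s, {subset s <= N} & v = \sum_(c <- s) val c.

Lemma ncomb0 N : ncomb N 0.
Proof. by exists [::]; rewrite ?big_nil. Qed.

Lemma ncombD N v v' : ncomb N v -> ncomb N v' -> ncomb N (v + v').
Proof.
move=> [s hs ->] [s' hs' ->]; exists (s ++ s'); last by rewrite big_cat.
by move=> c; rewrite mem_cat => /orP[/hs|/hs'].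
Qed.

Lemma ncomb_root N c : c \in N -> ncomb N (val c).
Proof.
move=> cN; exists [:: c]; last by rewrite big_seq1.
by move=> d; rewrite inE => /eqP ->.
Qed.

Lemma ncomb_sub N M v : (forall c, c \in N -> ncomb M (val c)) -> ncomb N v -> ncomb M v.
Proof.
move=> h [s hs ->]; elim: s hs => [|c s IH] hs; first by rewrite big_nil; apply: ncomb0.
rewrite big_cons; apply: ncombD; first by apply: h; rewrite hs ?mem_head.
by apply: IH => d ds; apply: hs; rewrite in_cons ds orbT.
Qed.

Lemma ncomb_ht N v : (forall c, c \in N -> 0 < c%:ht) -> ncomb N v -> 0 <= ht v.
Proof.
move=> h [s hs ->]; rewrite ht_sum big_seq sumr_ge0 // => c /hs /h; exact: ltW.
Qed.

Definition nclosed N := forall g, ncomb N (val g) -> g \in N.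

Definition ncl N : {set rootT} := [set g | `[< ncomb N (val g) >]].

Definition coclosed N := forall g m n, g \in N -> val g = val m + val n ->
  0 < m%:ht -> 0 < n%:ht -> m \in N \/ n \in N.

Lemma nclP N g : reflect (ncomb N (val g)) (g \in ncl N).
Proof. by rewrite inE; apply: asboolP. Qed.

Lemma ncl_sub N : N \subset ncl N.
Proof. by apply/subsetP => c cN; apply/nclP/ncomb_root. Qed.

Lemma ncl_min N M : N \subset M -> nclosed M -> ncl N \subset M.
Proof.
move=> /subsetP NM hM; apply/subsetP => g /nclP h; apply: hM; apply: ncomb_sub h => c cN.
by apply: ncomb_root; apply: NM.
Qed.

Lemma ncl_closed N : nclosed (ncl N).
Proof.
by move=> g h; apply/nclP; apply: ncomb_sub h => c /nclP.
Qed.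

Lemma pos_closed : nclosed (pos D).
Proof.
move=> g h; rewrite posE // lt_def ht_neq0 //=; apply: ncomb_ht h => c.
by rewrite posE.
Qed.

Lemma ncl_pos N : N \subset pos D -> ncl N \subset pos D.
Proof. by move=> h; apply: ncl_min h pos_closed. Qed.

Lemma wact_ncomb w N g : ncomb N (val g) -> ncomb (wact w @: N) (val (wact w g)).
Proof.
case=> s hs /(wact_sum w) ->; exists (map (wact w) s); last by rewrite big_map.
by move=> _ /mapP[c /hs cN ->]; apply: imset_f.
Qed.

Lemma ncomb_wact_ht w N g : (forall c, c \in N -> 0 < (wact w c)%:ht) ->
  ncomb N (val g) -> 0 < (wact w g)%:ht.
Proof.
move=> h /(wact_ncomb w) hg; rewrite -posE //; apply: pos_closed.
by apply: ncomb_sub hg => _ /imsetP[c cN ->]; apply: ncomb_root; rewrite posE ?h.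
Qed.

Lemma ncomb_wact_htN w N g : (forall c, c \in N -> (wact w c)%:ht < 0) ->
  ncomb N (val g) -> (wact w g)%:ht < 0.
Proof.
move=> h /(wact_ncomb w)[s hs e].
rewrite lt_neqAle ht_neq0 // e ht_sum big_seq sumr_le0 // => _ /hs /imsetP[c cN ->].
by rewrite ltW ?h.
Qed.

Lemma inv_closed w : nclosed (inversions w).
Proof.
move=> g h; rewrite mem_inv (ncomb_wact_htN _ h) ?andbT => [|c]; last first.
  by rewrite mem_inv => /andP[].
rewrite -posE //; apply: pos_closed; apply: ncomb_sub h => c /(subsetP (inv_sub_pos _)).
exact: ncomb_root.
Qed.

Lemma noninv_closed w : nclosed (pos D :\: inversions w).
Proof.
have hN c : c \in pos D :\: inversions w -> 0 < c%:ht /\ 0 < (wact w c)%:ht.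
  rewrite in_setD posE // mem_inv => /andP[h1 h2]; split=> //.
  by rewrite ht_sign //; apply: contra h1 => ->; rewrite h2.
move=> g h; have hg : 0 < g%:ht.
  rewrite -posE //; apply: pos_closed; apply: ncomb_sub h => c /hN[hc _].
  by apply: ncomb_root; rewrite posE.
rewrite in_setD posE // hg andbT mem_inv hg /= -ht_sign //.
by apply: ncomb_wact_ht h => c /hN[].
Qed.

Lemma inv_coclosed w : coclosed (inversions w).
Proof.
move=> g m n; rewrite !mem_inv => /andP[hg hw] e hm hn; rewrite hm hn /=.
have := hw; rewrite (wactD w e) htD => h.
by case: (ltrP (wact w m)%:ht 0) => h1; [left|right; lra].
Qed.

Lemma coclosedU N M : coclosed N -> coclosed M -> coclosed (N :|: M).
Proof.
move=> hN hM g m n; rewrite !inE => /orP[gN|gM] e hm hn.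
  by case: (hN g m n) => // ->; [left|right].
by case: (hM g m n) => // ->; rewrite orbT; [left|right].
Qed.

Lemma coclosed_simple_root N : N \subset pos D -> coclosed N -> N != set0 ->
  exists2 a, a \in D & a \in N.
Proof.
move=> /subsetP Np hN /set0Pn[g gN]; apply: contrapT => hn.
have hg : 0 < g%:ht by rewrite -posE ?Np.
move: g hg gN; apply: ht_gt0_ind => // g hg IH gN.
have gD : g \notin D by apply/negP => gD; apply: hn; exists g.
have [m [n [hm hn' e]]] := pos_decomp hD hg gD.
by case: (hN g m n) => //; apply: IH => //; rewrite e htD ?ltrDl ?ltrDr.
Qed.

(** Induction on the number of summands of m + n.  A summand c with positive product
with m + n can be split off, and sum_sub_root transfers the subtraction to m or
to n.  If for instance r = m - c is positive, induction applies to r + n; if it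
is negative, c = m + (-r) lies in N, so m or -r does, and in the second case
n = (r + n) + (-r) is a sum of elements of N. *)
Lemma ncl_coclosed N : N \subset pos D -> coclosed N -> coclosed (ncl N).
Proof.
move=> Np hN g m n /nclP[s].
have [k] := ubnP (size s); elim: k s g m n => // k IH s g m n /ltnSE sk hs eg e hm hn.
have {}Np c : c \in N -> 0 < c%:ht by move=> cN; rewrite -posE // (subsetP Np).
have eg0 : val g = 0 + \sum_(c <- s) val c by rewrite add0r.
case: (pos_pairing eg0 (val_neq0 g)) => [|[c cs hgc]]; first by rewrite dot0r ltxx.
have cN := hs c cs.
have [egc|ngc] := eqVneq g c.
  have gN : g \in N by rewrite egc.
  by case: (hN _ _ _ gN e hm hn) => h; [left|right]; apply: (subsetP (ncl_sub N)).
have [b eb] := root_sub hgc ngc.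
have eb' : val b = \sum_(d <- rem c s) val d.
  rewrite eb eg (perm_big _ (perm_to_rem cs)) big_cons /= addrAC subrr add0r //.
have hs' : {subset rem c s <= N} by move=> d /mem_rem /hs.
have sk' : (size (rem c s) < k)%N.
  by rewrite size_rem //; case: (s) cs sk.
(* b = g - c; the part p of g absorbs the subtraction of c *)
have step (p q r : rootT) : val b = val r + val q -> val r = val p - val c -> 0 < p%:ht ->
    0 < q%:ht -> p \in ncl N \/ q \in ncl N.
  move=> ebr er hp hq; have bN : b \in ncl N by apply/nclP; exists (rem c s).
  have [hr|hr] := boolP (0 < r%:ht).
    case: (IH _ b r q sk' hs' eb' ebr hr hq) => [/nclP rN|]; last by right.
    left; apply/nclP; have -> : val p = val r + val c by rewrite er subrK.
    exact: ncombD rN (ncomb_root cN).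
  have hr' : 0 < (ropp r)%:ht.
    by have := hr; rewrite ht_sign // negbK ht_ropp oppr_gt0.
  have ec : val c = val p + val (ropp r).
    by rewrite val_ropp er opprB addrC subrK.
  case: (hN _ _ _ cN ec hp hr') => h; first by left; apply: (subsetP (ncl_sub N)).
  right; apply/nclP; have -> : val q = val b + val (ropp r).
    by rewrite ebr val_ropp addrC addKr.
  by apply: ncombD; [apply/nclP | apply: ncomb_root].
case: (sum_sub_root e eb) => [[ec|[r er]]|[ec|[r er]]].
- by left; apply: (subsetP (ncl_sub N)); rewrite ec.
- by apply: (step m n r) => //; rewrite eb e er addrAC.
- by right; apply: (subsetP (ncl_sub N)); rewrite ec.
- suff [] : n \in ncl N \/ m \in ncl N by [right|left].
  by apply: (step n m r) => //; rewrite eb e er -addrA addrC.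
Qed.

(** * Biclosed sets are inversion sets *)

(** Among the u of the Weyl group whose inversion set lies in B take one with the
largest inversion set, and suppose that B contains another root b.  Choose it
with u(b) of least height.  If u(b) is a simple root g, then the inversion set
of s_g u is that of u with b added, against maximality.  Otherwise u(b) is a sum
of two positive roots, and one of their preimages under u is again in B but not
an inversion of u, while its image has smaller height: by coclosedness if both preimages are positive, by closedness
if one of them is negative. *)
Lemma biclosed_inv B : B \subset pos D -> nclosed B -> coclosed B ->
  exists2 u, sgval u \in weyl Phi & inversions u = B.
Proof.
move=> /subsetP Bp cB ccB.
have P1 : (sgval (1%g : W) \in weyl Phi) && (inversions 1%g \subset B).
  rewrite group1 /=; apply/subsetP => b; rewrite mem_inv wact1 => /andP[]; lra.
case: (@arg_maxnP _ (1%g : W) [pred u : W | (sgval u \in weyl Phi) &&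
   (inversions u \subset B)] (fun u => #|inversions u|) P1).
move=> u /andP[uW /subsetP uB] umax; exists u => //; apply/eqP.
rewrite eqEsubset; apply/andP; split; first by apply/subsetP.
apply/subsetP => b bB; apply: contrapT => /negP bu.
have hb : 0 < (wact u b)%:ht.
  by rewrite ht_sign //; apply: contra bu => h; rewrite mem_inv h -posE // Bp.
(* g stands for u(b), so that the induction is on its height *)
suff H (g : rootT) : 0 < g%:ht -> wact u^-1%g g \in B -> wact u^-1%g g \notin inversions u -> False.
  by apply: (H _ hb); rewrite wactK.
move=> hg; move: g hg; apply: ht_gt0_ind => // g hg IH gB gu.
have [gD|gD] := boolP (g \in D).
  have rW : refl_perm g \in twisted_weyl Omega.
    by apply: (subsetP (joing_subr _ _)); apply: refl_perm_weyl.
  pose r : W := subg _ (refl_perm g).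
  have rE c : wact r c = refl_perm g c by rewrite /wact subgK.
  have hb0 : 0 < (wact u^-1%g g)%:ht by rewrite -posE // Bp.
  have rN c : (wact r (ropp c))%:ht = - (wact r c)%:ht by rewrite wactN ht_ropp.
  have rg : (wact r g)%:ht < 0.
    by rewrite rE refl_permE refl_fun_self htN oppr_lt0.
  have rP c : 0 < c%:ht -> c != g -> 0 < (wact r c)%:ht.
    by move=> hc nc; rewrite rE refl_perm_pos.
  have mE : inversions (wmul r u) = wact u^-1%g g |: inversions u.
    apply/setP => c; rewrite in_setU1 !mem_inv act_wmul.
    have [->|nc] := eqVneq c (wact u^-1%g g); first by rewrite wactVK hb0 rg.
    case: (ltrP 0 c%:ht) => //= hc.
    have [huc|huc] := boolP ((wact u c)%:ht < 0).
      rewrite -oppr_gt0 -rN rP //; first by rewrite ht_ropp oppr_gt0.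
      apply: contraTneq hb0 => e; rewrite -e wactN wactK ht_ropp -leNgt oppr_le0.
      exact: ltW.
    apply/negbTE; rewrite -ht_sign // rP //; first by rewrite ht_sign.
    by apply: contra nc => /eqP <-; rewrite wactK.
  have := umax (wmul r u); rewrite /= mE.
  have -> : sgval (wmul r u) \in weyl Phi.
    have -> : sgval (wmul r u) = (sgval u * sgval r)%g by [].
    by rewrite groupM // subgK // refl_perm_weyl.
  rewrite /= subUset sub1set gB /=.
  have -> : inversions u \subset B by apply/subsetP.
  by rewrite cardsU1 gu => /(_ isT); rewrite ltnn.
have [m [n [hm hn e]]] := pos_decomp hD hg gD.
have mg : m%:ht < g%:ht by rewrite e htD ltrDl.
have ng : n%:ht < g%:ht by rewrite e htD ltrDr.
have e' := wactD u^-1%g e.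
have fin (p : rootT) : 0 < p%:ht -> p%:ht < g%:ht -> wact u^-1%g p \in B -> False.
  by move=> h1 h2 h3; apply: (IH p) => //; apply: notin_inv; rewrite wactVK.
have step (p q : rootT) :
    val (wact u^-1%g g) = val (wact u^-1%g p) + val (wact u^-1%g q) ->
    0 < p%:ht -> 0 < q%:ht -> q%:ht < g%:ht -> (wact u^-1%g p)%:ht < 0 -> False.
  move=> e2 hp hq qg hup; apply: (fin q) => //.
  have pu : ropp (wact u^-1%g p) \in inversions u by apply: ropp_inv; rewrite ?wactVK.
  apply: cB; have -> : val (wact u^-1%g q) =
      val (wact u^-1%g g) + val (ropp (wact u^-1%g p)).
    by rewrite val_ropp e2 addrC addKr.
  by apply: ncombD; apply: ncomb_root => //; apply: uB.
have [hmn|hpm] := boolP ((wact u^-1%g m)%:ht < 0); first exact: (step m n).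
have [hnn|hpn] := boolP ((wact u^-1%g n)%:ht < 0).
  by apply: (step n m) => //; rewrite e' addrC.
by case: (ccB _ _ _ gB e'); rewrite ?ht_sign //; apply: fin.
Qed.

(** * Crossing preserves coclosedness *)

(** The condition for w(g) to lie in the crossing set of N, up to positivity of w(g). *)
Definition raised w N g := exists2 b, b \in N & ncomb (inversions w) (val g - val b).

Lemma raised_root w N b : b \in N -> raised w N b.
Proof. by exists b => //; rewrite subrr; apply: ncomb0. Qed.

Lemma raisedD w N b c g : raised w N b -> c \in inversions w -> val g = val b + val c ->
  raised w N g.
Proof.
case=> d dN hb cw e; exists d => //; rewrite e addrAC.
by apply: ncombD hb (ncomb_root cw).
Qed.

Lemma crossP w N g : reflect (0 < g%:ht /\ raised w N (wact w^-1%g g)) (g \in cross D w N).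
Proof.
apply: (iffP bigcupP) => [[b bN]|[hg [b bN [s hs e]]]].
  rewrite in_setI posE // => /andP[/imsetP[h]]; rewrite inE => /asboolP[s [hs e]] -> hh.
  by split=> //; exists b => //; rewrite wactK; exists s => //; rewrite e addrC addKr.
exists b => //; rewrite in_setI posE // hg andbT; apply/imsetP.
exists (wact w^-1%g g); last by rewrite wactVK.
by rewrite inE; apply/asboolP; exists s; split=> //; rewrite -e addrC subrK.
Qed.

Lemma cross_pos w N : cross D w N \subset pos D.
Proof. by apply/subsetP => g /crossP[]; rewrite posE. Qed.

Lemma raised_pos w N g : N \subset pos D -> raised w N g -> 0 < g%:ht.
Proof.
move=> /subsetP Np [b /Np bN hb]; rewrite -posE //; apply: pos_closed.
rewrite -(subrK (val b) (val g)); apply: ncombD; last exact: ncomb_root.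
by apply: ncomb_sub hb => c /(subsetP (inv_sub_pos w)); apply: ncomb_root.
Qed.

(** Write m + n = b + d_1 + ... + d_k with b in N and inversions d_i.  If m or n is
negative, its opposite is an inversion, and adding it to m + n gives the other
one.  Otherwise some d_i, or else b, has positive product with m + n.  In the
first case subtract d_i and use induction on k.  In the second case m + n - b is
zero or a root, and then an inversion d, being a sum of inversions: the identity
m + n = b + d reduces to k = 1, and b is split by coclosedness of N.  Both cases
use sum_sub_root to pass from a splitting of m + n - d to one of m + n. *)
Lemma raised_split w N g m n : N \subset pos D -> coclosed N -> raised w N g ->
  val g = val m + val n -> 0 < (wact w m)%:ht -> 0 < (wact w n)%:ht ->
  raised w N m \/ raised w N n.
Proof.
move=> /subsetP Np hN [b bN [s]].
have [k] := ubnP (size s); elim: k s g m n => // k IH s g m n /ltnSE sk hs eg e hm hn.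
have gK : raised w N g by exists b => //; exists s.
have [hm0|hm0] := boolP (0 < m%:ht); last first.
  right; apply: (raisedD gK (ropp_inv _ hm)) => //.
    by move: hm0; rewrite ht_sign // negbK.
  by rewrite val_ropp e addrC addKr.
have [hn0|hn0] := boolP (0 < n%:ht); last first.
  left; apply: (raisedD gK (ropp_inv _ hn)) => //.
    by move: hn0; rewrite ht_sign // negbK.
  by rewrite val_ropp e addrK.
have hwg : 0 < (wact w g)%:ht by rewrite (wactD w e) htD addr_gt0.
have winv c : c \in inversions w -> (wact w c)%:ht < 0 by rewrite mem_inv // => /andP[].
(* h = p + q - c, with h already split; q is the part left unchanged and r = p - c
   the part from which the inversion c is taken *)
have step1 (c h p q r : rootT) : c \in inversions w -> raised w N h ->
    (forall m' n', val h = val m' + val n' -> 0 < (wact w m')%:ht ->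
       0 < (wact w n')%:ht -> 0 < m'%:ht -> 0 < n'%:ht -> raised w N m' \/ raised w N n') ->
    val h = val r + val q -> val r = val p - val c ->
    0 < (wact w p)%:ht -> 0 < (wact w q)%:ht -> 0 < q%:ht ->
    raised w N p \/ raised w N q.
  move=> cw hK spl eh er hp hq hq0.
  have ep : val p = val r + val c by rewrite er subrK.
  have hr : 0 < (wact w r)%:ht.
    by apply: lt_trans hp _; rewrite (wactD w ep) htD gtrDl winv.
  have [hr0|hr0] := boolP (0 < r%:ht).
    case: (spl _ _ eh hr hq hr0 hq0) => h1; [left|by right].
    exact: raisedD h1 cw ep.
  right; apply: (raisedD hK (ropp_inv _ hr)) => //.
    by move: hr0; rewrite ht_sign // negbK.
  by rewrite val_ropp eh addrC addKr.
have step (c h : rootT) : c \in inversions w -> raised w N h -> val h = val g - val c ->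
    (forall m' n', val h = val m' + val n' -> 0 < (wact w m')%:ht ->
       0 < (wact w n')%:ht -> 0 < m'%:ht -> 0 < n'%:ht -> raised w N m' \/ raised w N n') ->
    raised w N m \/ raised w N n.
  move=> cw hK eh spl; case: (sum_sub_root e eh) => [[ec|[r er]]|[ec|[r er]]].
  - by have := winv c cw; rewrite -ec ltNge ltW.
  - by apply: (step1 c h m n r) => //; rewrite eh e er addrAC.
  - by have := winv c cw; rewrite -ec ltNge ltW.
  - suff [] : raised w N n \/ raised w N m by [right|left].
    by apply: (step1 c h n m r) => //; rewrite eh e er -addrA addrC.
have eg0 : val g = val b + \sum_(c <- s) val c by rewrite -eg addrC subrK.
case: (pos_pairing eg0 (val_neq0 g)) => [hgb|[c cs hgc]].
  have [egb|ngb] := eqVneq g b.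
    rewrite -egb in bN; case: (hN g m n bN e hm0 hn0) => h; [left|right]; exact: raised_root.
  have [c ec] := root_sub hgb ngb.
  apply: (step c b) => //.
  - by apply: inv_closed => //; exists s => //; rewrite ec.
  - exact: raised_root.
  - by rewrite ec opprB addrC subrK.
  - move=> m' n' e' _ _ h1 h2.
    by case: (hN b m' n' bN e' h1 h2) => h; [left|right]; apply: raised_root.
have cw := hs c cs.
have ngc : g != c by apply: contraTneq hwg => ->; rewrite -leNgt ltW ?winv.
have [h eh] := root_sub hgc ngc.
have hs' : {subset rem c s <= inversions w} by move=> d /mem_rem /hs.
have eh' : val h - val b = \sum_(d <- rem c s) val d.
  rewrite eh addrAC eg (perm_big _ (perm_to_rem cs)) big_cons /= addrAC subrr add0r //.
have sk' : (size (rem c s) < k)%N by rewrite size_rem //; case: (s) cs sk.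
apply: (step c h) => //; first by exists b => //; exists (rem c s).
by move=> m' n' e' h1 h2 _ _; apply: (IH _ h m' n' sk' hs' eh' e').
Qed.

Lemma cross_coclosed w N : N \subset pos D -> coclosed N -> coclosed (cross D w N).
Proof.
move=> Np hN g m n /crossP[hg gK] e hm hn.
have := raised_split Np hN gK (wactD w^-1%g e).
rewrite !wactVK => /(_ hm hn)[h|h]; [left|right]; exact/crossP.
Qed.

Lemma iter_cross_coclosed w N d : N \subset pos D -> coclosed N ->
  iter d (cross D w) N \subset pos D /\ coclosed (iter d (cross D w) N).
Proof.
move=> Np hN; elim: d => //= d [IH1 IH2]; split; first exact: cross_pos.
exact: cross_coclosed.
Qed.

Lemma coclosed_eq0 N : N \subset pos D -> coclosed N ->
  (N = set0 <-> forall a, a \in D -> a \notin N).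
Proof.
move=> Np hN; split=> [-> a _|h]; first by rewrite inE.
apply/eqP; apply: contrapT => /negP /(coclosed_simple_root Np hN)[a aD aN].
by have := h a aD; rewrite aN.
Qed.

(** The singleton of a simple root is coclosed, and its crossing set contains the
image of that root under w. *)
Lemma simple_crossing w a : a \in D -> a \notin inversions w ->
  exists2 b, b \in D & b \in cross1 D w a.
Proof.
move=> aD aw.
have ap : [set a] \subset pos D by rewrite sub1set posE // ht_simple_gt0.
have ac : coclosed [set a].
  (* a root that is a sum of two positive roots has height at least 2 *)
  move=> g m n /set1P-> /(congr1 ht); rewrite htD ht_simple // => e.
  by move=> /(ht_pos_ge1 hD) hm /(ht_pos_ge1 hD) hn; exfalso; lra.
have e1 : cross D w [set a] = cross1 D w a by rewrite /cross big_set1.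
have [||b bD bN] := coclosed_simple_root (cross_pos w [set a]).
- exact: cross_coclosed.
- apply/set0Pn; exists (wact w a); apply/crossP; rewrite wactK; split.
    move: aw; rewrite mem_inv // ht_simple_gt0 //= ht_sign //.
  by apply: raised_root; rewrite inE.
by exists b => //; rewrite -e1.
Qed.

(** * Reduced products and joins *)

Lemma inv_subset_mul w z : (forall g, g \in inversions z -> 0 < (wact w^-1%g g)%:ht) ->
  inversions w \subset inversions (wmul z w).
Proof.
move=> h; apply/subsetP => b; rewrite !mem_inv => /andP[hb hwb].
rewrite hb act_wmul ltNge /=; apply/negP => hz.
have hz' : 0 < (wact z (wact w b))%:ht by rewrite lt_def ht_neq0.
have := h _ (ropp_inv hwb hz').
by rewrite wactN wactK ht_ropp; lra.
Qed.

Lemma inv_mul_pos w z g : inversions w \subset inversions (wmul z w) ->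
  g \in inversions z -> 0 < (wact w^-1%g g)%:ht.
Proof.
move=> /subsetP h; rewrite mem_inv => /andP[hg hz]; rewrite ht_sign //; apply/negP => hn.
have := h (ropp (wact w^-1%g g)).
rewrite !mem_inv act_wmul !wactN wactVK !ht_ropp.
rewrite oppr_gt0 hn oppr_lt0 hg /= => /(_ isT); lra.
Qed.

Lemma mem_inv_mul w z b : inversions w \subset inversions (wmul z w) ->
  (b \in inversions (wmul z w)) =
  (b \in inversions w) || (0 < b%:ht) && (wact w b \in inversions z).
Proof.
move=> h; have [bw|] := boolP (b \in inversions w); first by rewrite (subsetP h).
rewrite !mem_inv act_wmul; case: (ltrP 0 b%:ht) => //= hb.
by move=> hw; rewrite ht_sign // hw.
Qed.

Definition reduced x y := inversions y \subset inversions (wmul x y).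

(** Equivalently, the inversion sets of x and of the inverse of y are disjoint. *)
Lemma reducedP x y : reflect (forall g, g \in inversions x -> 0 < (wact y^-1%g g)%:ht)
  (reduced x y).
Proof.
apply: (iffP idP) => [h g|]; first exact: inv_mul_pos.
exact: inv_subset_mul.
Qed.

Lemma wmulVK x y : wmul (wmul x y^-1%g) y = x.
Proof. by rewrite /wmul mulKVg. Qed.
Lemma wmulA x y z : wmul x (wmul y z) = wmul (wmul x y) z.
Proof. by rewrite /wmul mulgA. Qed.
Lemma wmulx1 x : wmul x 1%g = x.
Proof. by rewrite /wmul mul1g. Qed.

(** The inversions of x are, up to sign, the images under y of the symmetric
difference of the inversion sets of y and of the product. *)
Lemma len_wmul_eq x y :
  (len D (wmul x y) + (#|inversions y :\: inversions (wmul x y)|).*2 =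
   len D x + len D y)%N.
Proof.
set z := wmul x y; set Y := inversions y; set Z := inversions z.
(* f maps S onto the inversions of x; positivity of S makes it injective *)
pose f b := if b \in Y then ropp (wact y b) else wact y b.
pose S := (Z :\: Y) :|: (Y :\: Z).
have S_pos b : b \in S -> 0 < b%:ht.
  rewrite -posE // !inE => /orP[/andP[_]|/andP[_]] => /andP[-> //].
have no_opp b c : b \in S -> c \in S -> wact y b != ropp (wact y c).
  move=> /S_pos hb /S_pos hc; rewrite -wactN (can_eq (wactK y)).
  by apply: contraTneq hb => ->; rewrite ht_ropp -leNgt oppr_le0 ltW.
have f_inj : {in S &, injective f}.
  move=> b c bS cS; rewrite /f; case: ifP => _; case: ifP => _.
  - by move=> /(can_inj (@roppK _ _ _)) /(can_inj (wactK y)).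
  - by move=> /esym/eqP; rewrite (negPf (no_opp c b cS bS)).
  - by move=> /eqP; rewrite (negPf (no_opp b c bS cS)).
  - by move=> /(can_inj (wactK y)).
have im : inversions x = f @: S.
  apply/setP => g; apply/idP/imsetP.
    rewrite mem_inv => /andP[hg hx].
    have [hb|hb] := boolP ((wact y^-1%g g)%:ht < 0).
      have bY : ropp (wact y^-1%g g) \in Y by apply: ropp_inv; rewrite ?wactVK.
      exists (ropp (wact y^-1%g g)); last by rewrite /f bY wactN wactVK roppK.
      rewrite in_setU !in_setD bY andbT; apply/orP; right.
      by apply: notin_inv; rewrite act_wmul !wactN wactVK ht_ropp oppr_gt0.
    have hb0 : 0 < (wact y^-1%g g)%:ht by rewrite ht_sign.
    have bY : wact y^-1%g g \notin Y by apply: notin_inv; rewrite wactVK.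
    exists (wact y^-1%g g); last by rewrite /f (negPf bY) wactVK.
    by rewrite in_setU !in_setD bY mem_inv hb0 act_wmul wactVK hx.
  case=> b bS ->; have hb := S_pos b bS; move: bS.
  rewrite /f in_setU !in_setD; case: ifP => [bY|/negbT bY] /=; rewrite ?andbT ?andbF ?orbF.
    move=> /(notin_inv_pos hb) hz; rewrite mem_inv wactN !ht_ropp oppr_gt0 oppr_lt0.
    by rewrite -act_wmul hz andbT; move: bY; rewrite mem_inv => /andP[].
  move=> bZ; rewrite mem_inv (notin_inv_pos hb bY) -act_wmul.
  by move: bZ; rewrite mem_inv => /andP[].
have -> : len D x = (#|Z :\: Y| + #|Y :\: Z|)%N.
  rewrite /len im (card_in_imset f_inj) cardsU (_ : _ :&: _ = set0) ?cards0 ?subn0 //.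
  by apply/setP => b; rewrite in_setI !in_setD in_set0; case: (b \in Y); case: (b \in Z).
rewrite /len -/Z -/Y -(cardsID Y Z) -(cardsID Z Y) setIC; lia.
Qed.

Lemma reduced_len x y : reflect (len D (wmul x y) = len D x + len D y)%N (reduced x y).
Proof.
have := len_wmul_eq x y; rewrite /reduced -setD_eq0 -cards_eq0.
case: #|_| => [|k] h; constructor; lia.
Qed.

Lemma weak_leE x y : weak_le D x y <-> inversions x \subset inversions y.
Proof.
rewrite /weak_le; have := reduced_len (wmul y x^-1%g) x; rewrite /reduced wmulVK => h.
by split=> [/(introT h)|/(elimT h)].
Qed.

Lemma inv_of_ncl N : N \subset pos D -> coclosed N ->
  exists2 u, sgval u \in weyl Phi & inversions u = ncl N.
Proof.
move=> Np hN; apply: (biclosed_inv); [exact: ncl_pos|exact: ncl_closed|].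
exact: ncl_coclosed.
Qed.

(** The last clause makes z the join in the weak order, since inversion sets are
closed; it also applies to complements of inversion sets in the positive roots. *)
Lemma inv_join x y : exists z, [/\ inversions x \subset inversions z,
  inversions y \subset inversions z & forall B, nclosed B -> inversions x \subset B ->
    inversions y \subset B -> inversions z \subset B].
Proof.
have [z _ hz] : exists2 u, sgval u \in weyl Phi &
    inversions u = ncl (inversions x :|: inversions y).
  apply: inv_of_ncl; first by rewrite subUset !inv_sub_pos.
  by apply: coclosedU; apply: inv_coclosed.
have := ncl_sub (inversions x :|: inversions y).
rewrite subUset -hz => /andP[h1 h2]; exists z; split=> // B cB xB yB.
by rewrite hz; apply: ncl_min => //; rewrite subUset xB yB.
Qed.

Lemma reduced_noninv x z : reduced x z =
  (inversions x \subset pos D :\: inversions z^-1%g).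
Proof.
apply/reducedP/subsetP => h g gx.
  rewrite in_setD (subsetP (inv_sub_pos x)) // andbT mem_inv // negb_and.
  by rewrite -[~~ (_ (_ _) < 0)]ht_sign // h // orbT.
have := h g gx; rewrite in_setD mem_inv // posE // => /andP[h1 h2].
by move: h1; rewrite h2 /= ht_sign.
Qed.

(** The complement of the inversion set of the inverse of u is closed under sums, so
it contains the join as soon as it contains both parts. *)
Lemma reduced_join x y z u : reduced x u -> reduced y u ->
  (forall B, nclosed B -> inversions x \subset B -> inversions y \subset B ->
    inversions z \subset B) -> reduced z u.
Proof.
rewrite !reduced_noninv => hx hy; apply=> //; exact: noninv_closed.
Qed.

Lemma inv_mul_mono x y z : reduced x z -> inversions x \subset inversions y ->
  reduced y z -> inversions (wmul x z) \subset inversions (wmul y z).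
Proof.
move=> hx /subsetP h hy; apply/subsetP => b; rewrite !mem_inv_mul //.
by case/orP=> [->//|/andP[-> /h ->]]; rewrite orbT.
Qed.

Lemma inv_mul_cancel x y z : reduced x z -> reduced y z ->
  inversions (wmul x z) \subset inversions (wmul y z) -> inversions x \subset inversions y.
Proof.
move=> hx hy /subsetP h; apply/subsetP => g gx.
have hg := reducedP _ _ hx g gx.
have := h (wact z^-1%g g); rewrite !mem_inv_mul // wactVK gx hg /= orbT => /(_ isT).
case/orP=> //; rewrite mem_inv // wactVK => /andP[_].
by have := subsetP (inv_sub_pos x) g gx; rewrite posE //; lra.
Qed.

(** * Right factors of braids *)

(** The word is read from its last letter.  A right factor of b b_w lies below a
reduced product zw where z is a right factor of b; this is right_factorP. *)
Fixpoint below (r : seq W) y : Prop :=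
  if r is w :: r' then
    exists z, [/\ reduced z w, inversions y \subset inversions (wmul z w) & below r' z]
  else inversions y = set0.

Lemma below_sub r x y : inversions x \subset inversions y -> below r y -> below r x.
Proof.
case: r => [|w r] /= h; first by move=> e; move: h; rewrite e subset0 => /eqP.
by case=> z [h1 h2 h3]; exists z; split=> //; apply: subset_trans h h2.
Qed.

Lemma inv1 : inversions (1%g : W) = set0.
Proof. by apply/setP => b; rewrite mem_inv // wact1 inE; case: ltrgtP. Qed.

Lemma below1 r : below r 1%g.
Proof.
elim: r => /= [|w r IH]; first exact: inv1.
exists 1%g; split=> //; last by rewrite inv1 sub0set.
by apply/reducedP => g; rewrite inv1 inE.
Qed.

Lemma below_join r x y : below r x -> below r y ->
  exists z, [/\ inversions x \subset inversions z, inversions y \subset inversions z & below r z].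
Proof.
elim: r x y => /= [|w r IH] x y.
  by move=> hx hy; exists x; rewrite hx hy.
case=> [x1 [rx sx bx]] [y1 [ry sy hy]].
have [z [hz1 hz2 hz3]] := inv_join x1 y1.
have rz : reduced z w by apply: reduced_join hz3.
exists (wmul z w); split.
- by apply: subset_trans sx _; apply: inv_mul_mono.
- by apply: subset_trans sy _; apply: inv_mul_mono.
have [z2 [xz2 yz2 bz2]] := IH _ _ bx hy.
exists z; split=> //; apply: below_sub bz2.
by apply: hz3 => //; apply: inv_closed.
Qed.

(** From left to right, the intermediate element z2 below a reduced product z1 x
need not be a left multiple of x, and is replaced by its join with x: the product
of that join with y is still reduced, and the join stays below z1 x. *)
Lemma below_mul r x y z : reduced x y -> below [:: y, x & r] z <-> below (wmul x y :: r) z.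
Proof.
move=> rxy; split=> /=.
  case=> z2 [r2 s2 [z1 [r1 s1 b1]]].
  have [j [j1 j2 j3]] := inv_join z2 x.
  have rj : reduced j y by apply: reduced_join j3.
  have rz : reduced (wmul j x^-1%g) x by rewrite /reduced wmulVK.
  exists (wmul j x^-1%g); rewrite wmulA wmulVK; split.
  - rewrite /reduced wmulA wmulVK; apply: inv_mul_mono => //.
  - by apply: subset_trans s2 _; apply: inv_mul_mono.
  apply: below_sub b1; apply: (inv_mul_cancel rz r1); rewrite wmulVK.
  by apply: j3 => //; apply: inv_closed.
case=> z1 [r1 s1 b1].
have rzx : reduced z1 x.
  apply/reducedP => g gz; have := reducedP _ _ r1 g gz.
  rewrite {1}/wmul invMg -/(wmul y^-1%g x^-1%g) act_wmul => hg.
  rewrite ht_sign //; apply/negP => hn.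
  have gx : ropp (wact x^-1%g g) \in inversions x.
    by apply: ropp_inv; rewrite // wactVK -posE // (subsetP (inv_sub_pos z1)).
  by have := reducedP _ _ rxy _ gx; rewrite wactN ht_ropp oppr_gt0 ltNge ltW.
have rzxy : reduced (wmul z1 x) y.
  by rewrite /reduced -wmulA; apply: subset_trans rxy r1.
by exists (wmul z1 x); rewrite -wmulA; split=> //; exists z1.
Qed.

Lemma below_cat r r' t : (forall y, below r y <-> below r' y) ->
  forall y, below (t ++ r) y <-> below (t ++ r') y.
Proof.
move=> h; elim: t => //= w t IH y.
by split=> -[z [h1 h2 h3]]; exists z; split=> //; apply/IH.
Qed.

Lemma braid_eq_below (b b' : seq W) : braid_eq D b b' ->
  forall y, below (rev b) y <-> below (rev b') y.
Proof.
elim=> {b b'} [//|u v _ IH y|u v t _ IH1 _ IH2 y|u v x y h|u v] .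
- by rewrite IH.
- by rewrite IH1.
- rewrite !rev_cat !rev_cons -!cats1 -!catA /=; apply: below_cat => z.
  by apply: below_mul; apply/reduced_len.
rewrite !rev_cat !rev_cons -!cats1 -!catA /=; apply: below_cat => y /=.
split=> [[z [_ ]]|h]; first by rewrite wmulx1; apply: below_sub.
exists y; rewrite wmulx1; split=> //.
by rewrite /reduced inv1 sub0set.
Qed.

Lemma braid_eq_cat (b b' t : seq W) : braid_eq D b b' -> braid_eq D (b ++ t) (b' ++ t).
Proof.
elim=> {b b'} [u|u v _ IH|u v r _ IH1 _ IH2|u v x y h|u v].
- exact: braid_refl.
- exact: braid_sym.
- exact: braid_trans IH2.
- by rewrite -!catA; apply: braid_mul.
by rewrite -!catA; apply: braid_one.
Qed.

Lemma right_factorP (b : seq W) y : right_factor D b y <-> below (rev b) y.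
Proof.
split=> [[b' /braid_eq_below ->]|].
  rewrite rev_rcons /=; exists 1%g; split; last exact: below1.
    by apply/reducedP => g; rewrite inv1 inE.
  by rewrite /wmul mulg1.
elim/last_ind: b y => [|b w IH] y /=.
  move=> /= hy; exists [:: y^-1%g].
  have e1 : wmul y^-1%g y = 1%g by rewrite /wmul mulgV.
  have h0 : braid_eq D [:: 1%g] [::] := @braid_one _ _ _ D Omega [::] [::].
  have h1 : braid_eq D [:: y^-1%g; y] [:: wmul y^-1%g y].
    apply: (@braid_mul _ _ _ D Omega [::] [::]).
    by apply/reduced_len; rewrite /reduced hy sub0set.
  by apply: braid_sym; apply: braid_trans h0; rewrite -e1.
rewrite rev_rcons /= => -[z [rz yz /IH[b' hb']]].
pose v := wmul (wmul z w) y^-1%g; exists (rcons b' v).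
have := braid_eq_cat [:: w] hb'; rewrite !cats1 => /braid_trans; apply.
rewrite -!cats1 -!catA /=.
have h1 : braid_eq D (b' ++ [:: z; w]) (b' ++ [:: wmul z w]).
  by apply: braid_mul; apply/reduced_len.
apply: braid_trans h1 _; rewrite (_ : wmul z w = wmul v y); last by rewrite wmulVK.
apply: braid_sym; apply: braid_mul; apply/reduced_len.
by rewrite /reduced wmulVK.
Qed.

(** A right factor of maximal length is a maximum, because it shares an upper bound
among the right factors with any other one. *)
Lemma DGP (b : seq W) : is_DG D b (DG D b).
Proof.
rewrite /DG; case: pickP => [x /asboolP //|none]; exfalso.
have P1 : `[< below (rev b) 1%g >] by apply/asboolP/below1.
case: (@arg_maxnP _ (1%g : W) (fun y => `[< below (rev b) y >]) (len D (Omega := Omega)) P1).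
move=> x /asboolP hx hmax; move/negbT/asboolPn: (none x); apply.
split=> [|y /right_factorP hy]; first exact/right_factorP.
have [z [xz yz /asboolP/hmax hz]] := below_join hx hy.
apply/weak_leE; suff -> : inversions x = inversions z by [].
by apply/eqP; rewrite eqEcard xz.
Qed.

Lemma below_DG (b : seq W) y : below (rev b) y <-> inversions y \subset inversions (DG D b).
Proof.
have [/right_factorP h1 h2] := DGP b; split=> [/right_factorP/h2/weak_leE //|h].
exact: below_sub h1.
Qed.

(** * Crossing detects the Deligne-Garside factor *)

(** For the implication from left to right in the inductive step, the crossing set
is coclosed, so the sums of its elements form the inversion set of some u; all of
them stay positive under the inverse of w, so uw is reduced. *)
Lemma cross_below w N d : N \subset pos D -> coclosed N ->
  (iter d (cross D w) N = set0 <-> exists2 y, below (nseq d w) y & N \subset inversions y).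
Proof.
elim: d N => [|d IH] N Np hN.
  split=> [/= ->|[y /= -> ]]; last by rewrite subset0 => /eqP.
  by exists 1%g; [apply: inv1 | apply: sub0set].
rewrite iterSr IH ?cross_pos //; last exact: cross_coclosed.
split=> [[z bz cz]|[y /= [z [rz yz bz]] Ny]].
  have [u _ hu] := inv_of_ncl (cross_pos w N) (cross_coclosed (w := w) Np hN).
  have uz : inversions u \subset inversions z.
    by rewrite hu; apply: ncl_min => //; apply: inv_closed.
  have ru : reduced u w.
    rewrite reduced_noninv hu; apply: ncl_min; last exact: noninv_closed.
    apply/subsetP => g /crossP[hg gK].
    by rewrite in_setD posE // hg andbT notin_inv // (raised_pos Np gK).
  exists (wmul u w).
    by exists u; split=> //; apply: below_sub bz.
  apply/subsetP => b bN; rewrite mem_inv_mul //.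
  have [//|bw] := boolP (b \in inversions w).
  have hb : 0 < b%:ht by rewrite -posE // (subsetP Np).
  rewrite hb hu /=; apply: (subsetP (ncl_sub _)); apply/crossP; rewrite wactK.
  split; last exact: raised_root.
  by move: bw; rewrite mem_inv // hb ht_sign.
exists z => //; apply/subsetP => g /crossP[hg [b bN hb]].
have : wact w^-1%g g \in inversions (wmul z w).
  apply: inv_closed => //; rewrite -(subrK (val b) (val _)); apply: ncombD.
    by apply: ncomb_sub hb => c cw; apply: ncomb_root; apply: (subsetP rz).
  by apply: ncomb_root; apply: (subsetP yz); apply: (subsetP Ny).
rewrite mem_inv_mul // wactVK => /orP[|/andP[]//].
rewrite mem_inv // wactVK => /andP[_]; lra.
Qed.

Lemma iter_cross_eq0 w N d : N \subset pos D -> coclosed N ->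
  (iter d (cross D w) N = set0 <-> N \subset inversions (DG D (braid_power w d))).
Proof.
move=> Np hN; rewrite cross_below //.
have e : rev (braid_power w d) = nseq d w by rewrite /braid_power rev_nseq.
split=> [[y]|h]; last by exists (DG D (braid_power w d)) => //; rewrite -e; apply/below_DG.
by rewrite -e => /below_DG h1 h2; apply: subset_trans h2 h1.
Qed.

(** * Unstable roots and the power bound *)

Lemma stable_posP w b : 0 < b%:ht -> (b \in stable D w <->
  forall i, 0 < (wact (w ^+ i)%g b)%:ht /\ 0 < (wact (w ^- i)%g b)%:ht).
Proof.
move=> hb; rewrite inE; split=> [/asboolP[h i|/(_ 0%N)[]]|h].
- by have := h i; rewrite !posE.
- by rewrite expg0 wact1 negHt // ltNge ltW.
- by apply/asboolP; left=> i; rewrite !posE.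
Qed.

Lemma unstable_sub_pos w : unstable_pos D w \subset pos D.
Proof. exact: subsetDl. Qed.

Lemma unstable_coclosed w : coclosed (unstable_pos D w).
Proof.
move=> g m n; rewrite !in_setD !posE // => /andP[gu hg] e hm hn; rewrite hm hn !andbT.
apply/orP; rewrite -negb_and; apply: contra gu => /andP[].
move=> /(stable_posP _ hm) sm /(stable_posP _ hn) sn; apply/(stable_posP _ hg) => i.
have [m1 m2] := sm i; have [n1 n2] := sn i.
by split; rewrite (wactD _ e) htD addr_gt0.
Qed.

Lemma stable_iter_cross w N b d : b \in N -> 0 < b%:ht -> b \in stable D w ->
  wact (w ^+ d)%g b \in iter d (cross D w) N.
Proof.
move=> bN hb bs; elim: d => [|d IH] /=; first by rewrite expg0 wact1.
have [hd _] := (proj1 (stable_posP w hb) bs) d.+1; apply/crossP; split=> //.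
have -> : (w ^+ d.+1)%g = wmul w (w ^+ d)%g by rewrite /wmul expgSr.
by rewrite act_wmul wactK; apply: raised_root.
Qed.

(** The inversion set of DG has empty d-th crossing set, which for a stable root b
in it would contain w^d(b). *)
Lemma inv_DG_unstable w d : inversions (DG D (braid_power w d)) \subset unstable_pos D w.
Proof.
set y := DG D _; apply/subsetP => b bY.
have bp : b \in pos D := subsetP (inv_sub_pos y) b bY.
rewrite in_setD bp andbT; apply/negP => bs.
have hb : 0 < b%:ht by rewrite -posE.
have := stable_iter_cross d bY hb bs.
have -> : iter d (cross D w) (inversions y) = set0; last by rewrite inE.
by apply/(iter_cross_eq0 _ _ (inv_sub_pos y) (@inv_coclosed y)).
Qed.

Lemma pbP w : has_pb D w -> is_pb D w (pb D w).
Proof. by case=> x hx; rewrite /pb; case: pickP => [//|/(_ x)]; rewrite hx. Qed.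

Lemma unstable_has_pb w : nclosed (unstable_pos D w) -> has_pb D w.
Proof.
move=> h; have [u uW hu] :=
  biclosed_inv (unstable_sub_pos w) h (@unstable_coclosed w).
by exists u; rewrite /is_pb uW hu eqxx.
Qed.

(** Turns membership in a span into the vanishing of coordinates, which are additive
and nonnegative on positive roots. *)
Lemma standard_parabolic_coef (J : {set rootT}) b : J \subset D -> 0 < b%:ht ->
  (b \in standard_parabolic J <-> forall a, a \in D :\: J -> coef D a (val b) = 0).
Proof.
move=> /subsetP JD hb; rewrite inE; split=> [bJ a|h].
  rewrite in_setD => /andP[aJ aD].
  rewrite (coord_span (X := in_tuple [seq val c | c in J]) bJ) linear_sum big1 // => i _.
  have /mapP[c cJ /= ->] := mem_nth 0 (ltn_ord i).
  move: cJ; rewrite mem_enum => cJ; rewrite linearZ /= coef_simple ?(JD c) //.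
  have [eac|_] := eqVneq a c; last by rewrite mulr0.
  by move: aJ; rewrite eac cJ.
have /posP[k e] : b \in pos D by rewrite posE.
rewrite e; apply: memv_suml => a aD; have [aJ|aJ] := boolP (a \in J).
  by apply: rpredMn; apply: memv_span; apply: map_f; rewrite mem_enum.
have := h a; rewrite in_setD aJ aD (coef_pos hD aD e) => /(_ isT)/eqP.
by rewrite pnatr_eq0 => /eqP ->; rewrite mulr0n mem0v.
Qed.

(** The unstable positive roots are those with a nonzero coordinate outside J; this
condition is preserved by sums, so the set is closed as well as coclosed. *)
Lemma convex_has_pb w : convex D w -> has_pb D w.
Proof.
case=> J JD hJ; apply: unstable_has_pb => g gU.
have hU c : c \in unstable_pos D w -> 0 < c%:ht /\ c \notin standard_parabolic J.
  by rewrite in_setD posE // hJ => /andP[].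
have gp : g \in pos D.
  by apply: pos_closed; apply: ncomb_sub gU => c /hU[hc _]; apply: ncomb_root; rewrite posE.
have hg : 0 < g%:ht by rewrite -posE.
rewrite in_setD gp andbT hJ; apply/negP => /(standard_parabolic_coef JD hg) g0.
case: gU => -[|c s] hs e.
  by have := val_neq0 g; rewrite e big_nil eqxx.
have [hc /negP[]] := hU c (hs c (mem_head _ _)).
apply/(standard_parabolic_coef JD hc) => a aDJ; have := g0 a aDJ.
have aD : a \in D by move: aDJ; rewrite in_setD => /andP[].
have cge d : d \in c :: s -> 0 <= coef D a (val d).
  by move=> /hs /hU[hd _]; apply: coef_ge0 => //; rewrite posE.
rewrite e linear_sum /= big_cons => /eqP; rewrite paddr_eq0 ?cge ?mem_head //.
  by move=> /andP[/eqP].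
rewrite big_seq; apply: sumr_ge0 => d ds; apply: cge; by rewrite in_cons ds orbT.
Qed.

End Action.

Theorem mainTheorem2 (R : realType) (V : vectType R) (Phi : rootSystem V)
  (D : {set rootT Phi}) (Omega : {group {perm rootT Phi}})
  (hD : simple_system D) (hOmega : twists D Omega)
  (w : subg_of (twisted_weyl Omega)) :
  (* (i) *)
  (forall a : rootT Phi, a \in D -> a \notin inversions D w ->
     exists2 s : rootT Phi, s \in D & s \in cross1 D w a) /\
  (* (ii) *)
  (forall (w' : subg_of (twisted_weyl Omega)) (d : nat),
     let C := iter d (cross D w) (inversions D w') in
     (weak_le D w' (DG D (braid_power w d)) <-> C = set0) /\
     (C = set0 <-> forall s : rootT Phi, s \in D -> s \notin C)) /\
  (* (iii), the bound being d > #|unstable_pos| - len w over the integers.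
     [has_pb] is implied by [convex] (last clause) and replaces it, since the
     equivalence fails with [convex]: see the comment on [has_pb]. *)
  (forall d : nat, (#|unstable_pos D w| < d + len D w)%N ->
     let C := iter d (cross D w) (unstable_pos D w) in
     ((has_pb D w /\ eq_twist D (DG D (braid_power w d)) (pb D w))
        <-> C = set0) /\
     (C = set0 <-> forall s : rootT Phi, s \in D -> s \notin C)) /\
  (convex D w -> has_pb D w).
Proof.
split; first by move=> a aD aw; apply: simple_crossing.
split.
  move=> w' d C.
  have Np := inv_sub_pos D w'; have hN := inv_coclosed hD hOmega (w := w').
  have [Cp hC] := iter_cross_coclosed hD hOmega w d Np hN.
  split; last exact: coclosed_eq0.
  by rewrite (iter_cross_eq0 hD hOmega w d Np hN); apply: weak_leE.
split; last exact: convex_has_pb.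
move=> d _ C.
have Np := unstable_sub_pos D w; have hN := unstable_coclosed hD hOmega (w := w).
have [Cp hC] := iter_cross_coclosed hD hOmega w d Np hN.
split; last exact: coclosed_eq0.
rewrite (iter_cross_eq0 hD hOmega w d Np hN).
have DGU := inv_DG_unstable hD hOmega w d.
split=> [[/pbP/andP[_ /eqP pbU] e]|UDG]; first by rewrite -pbU -e.
have e : inversions D (DG D (braid_power w d)) = unstable_pos D w.
  by apply/eqP; rewrite eqEsubset DGU.
have pbw : has_pb D w.
  by apply: (unstable_has_pb hD hOmega); rewrite -e; apply: inv_closed.
split=> //; rewrite /eq_twist e.
by have /andP[_ /eqP ->] := pbP pbw.
Qed.
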